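(* Let $1<p<\infty$. (1) Let $T$ be a measure-preserving transformation of a probability space $(X,\mu)$, let $f\in L^p(X,\mu)$ and let $(a_n)_{n\ge1}$ be an arbitrary sequence of integers. Then $$\lim_{N\to\infty}\frac{1}{N(\log N)^{1/p}}\sum_{n=1}^N f(T^{a_n}x)=0\quad\text{for a.e. }x.$$ (2) Let $T$ be an aperiodic measure-preserving transformation of a probability space $(X,\mu)$ and let the sequence of positive real numbers $(M_N)$ satisfy $M_N/(N(\log N)^{1/p})\to0$ as $N\to\infty$. Then there exist $f\in L^p(X,\mu)$ and a sequence $(a_n)_{n\ge1}$ of integers such that $$\limsup_{N\to\infty}\frac{1}{M_N}\sum_{n=1}^N f(T^{a_n}x)=\infty\quad\text{for a.e. }x.$$ Further, the sequence $(a_n)$ may be taken to be the sequence $a_n=2^n$.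
   Context: A measure-preserving transformation $T$ of a probability space $(X,\mu)$ is aperiodic if $\mu\{x: T^nx=x\text{ for some }n\ge1\}=0$. If $T$ is not invertible, sequences of times $(a_n)$ are understood to consist of non-negative integers.
   Formalization: Part (2) additionally assumes that, up to a null set, countably many measurable sets separate the points of X (true for standard probability spaces); otherwise it fails, e.g. for an irrational rotation with the trivial sigma-algebra. Functions in L^p are taken real-valued. *)

(* Defs.v *)
From HB Require Import structures.
From mathcomp Require Export all_boot all_order all_algebra.
From mathcomp Require Export all_classical all_reals all_analysis.

Set Implicit Arguments.
Unset Strict Implicit.
Unset Printing Implicit Defensive.
Import Order.TTheory GRing.Theory Num.Theory.
Export numFieldNormedType.Exports.

Local Open Scope classical_set_scope.
Local Open Scope ring_scope.

Definition measure_preserving (R : realType) (d : measure_display)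
    (X : measurableType d) (mu : probability X R) (T : X -> X) : Prop :=
  measurable_fun [set: X] T /\
  forall A : set X, measurable A -> mu (T @^-1` A) = mu A.

Definition aperiodic (R : realType) (d : measure_display)
    (X : measurableType d) (mu : probability X R) (T : X -> X) : Prop :=
  mu.-negligible [set x | exists n : nat, (0 < n)%N /\ iter n T x = x].

(* Invertibility is understood modulo null sets, as usual for
   measure-preserving maps; such an inverse is itself measure-preserving and
   is determined almost everywhere. *)
Definition inverse_mod0 (R : realType) (d : measure_display)
    (X : measurableType d) (mu : probability X R) (T S : X -> X) : Prop :=
  [/\ measurable_fun [set: X] S,
      {ae mu, forall x, S (T x) = x} &
      {ae mu, forall x, T (S x) = x}].

Definition invertible (R : realType) (d : measure_display)
    (X : measurableType d) (mu : probability X R) (T : X -> X) : Prop :=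
  exists S : X -> X, inverse_mod0 mu T S.

(* Chosen inverse; the junk value [id] is taken when T is not invertible. *)
Definition inverse (R : realType) (d : measure_display)
    (X : measurableType d) (mu : probability X R) (T : X -> X) : X -> X :=
  @xget (X -> X) id [set S : X -> X | inverse_mod0 mu T S].

(* [Negz n] is the integer - n.+1. *)
Definition zpower (R : realType) (d : measure_display)
    (X : measurableType d) (mu : probability X R) (T : X -> X) (k : int) :
    X -> X :=
  match k with
  | Posz n => iter n T
  | Negz n => iter n.+1 (inverse mu T)
  end.

(* Sequences (a_n)_{n >= 1} are functions on nat whose value at 0 is
   irrelevant. *)
Definition times (R : realType) (d : measure_display)
    (X : measurableType d) (mu : probability X R) (T : X -> X)
    (a : nat -> int) : Prop :=
  ~ invertible mu T -> forall n : nat, (0 < n)%N -> 0 <= a n.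

Definition sampled_sum (R : realType) (d : measure_display)
    (X : measurableType d) (mu : probability X R) (T : X -> X)
    (a : nat -> int) (f : X -> R) (N : nat) (x : X) : R :=
  \sum_(1 <= n < N.+1) f (zpower mu T (a n) x).

(* Up to a null set, some countable family of measurable sets separates
   points.  Every standard (Lebesgue) probability space has this property.
   Without an assumption of this kind aperiodicity, being a condition on
   points, says nothing about measurable functions: with the trivial
   sigma-algebra on the circle, an irrational rotation is aperiodic, but every
   measurable real function is constant. *)
Definition countably_separated (R : realType) (d : measure_display)
    (X : measurableType d) (mu : probability X R) : Prop :=
  exists (X0 : set X) (E : nat -> set X),
    [/\ mu.-negligible (~` X0),
        forall k, measurable (E k) &
        forall x y, X0 x -> X0 y -> (forall k, E k x <-> E k y) -> x = y].

(* Main.v *)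
Require Import Defs.
From mathcomp Require Import measurable_realfun zify ring lra.
Set Implicit Arguments.
Unset Strict Implicit.
Unset Printing Implicit Defensive.
Import Order.TTheory GRing.Theory Num.Theory.
Local Open Scope classical_set_scope.
Local Open Scope ring_scope.

(** Upper bound.  The functions f o T^(a_n) all have the distribution of f, and
    nothing else about them is used.  Fix c > 0 and work at the dyadic scale
    N = 2^k.  The values at most c k^(1/p) contribute at most c N k^(1/p) to the
    sum.  The others have average of integral E(|f|; |f| > c k^(1/p)), and after
    division by k^(1/p) these integrals are summable over k: exchanging sum and
    integral, the sum over the k with k^(1/p) < |f| / c of |f| k^(-1/p) is of
    order |f|^p, because p > 1 ([sum_scaled_excess_le]).  Hence the normalised
    averages of the large values tend to 0 almost everywhere, and c is
    arbitrary ([ae_near_sum_le], [sampled_average_cvg0]).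

    Lower bound.  It is enough to treat a_n = 2^n.  Suppose that, for K large,
    there is a set F of measure about 1/K such that almost every x has, among K
    geometrically growing blocks of times, one block throughout which a
    positive proportion of the points T^(2^n) x lies in F.  Then K^(1/p) 1_F,
    of bounded norm, has a sum of order N K^(1/p) with N the end of the block,
    where log N is of order K: the upper bound is attained.

    On the integers such a set is built arithmetically.  Give an integer i one
    large binary digit for each block.  For n even, adding 2^n increases the
    digit of the block of n by 1 modulo 3 and leaves the others alone, up to
    rare overflows.  A linear combination of the digits with
    coefficients in (Z/3)^d, the coefficients running over all K = 3^d elements
    of the group, is a phase that is translated by a prescribed element during
    each block.  Let F be a level set of the phase of density at most 1/K.
    Whatever the phase of i, one of the blocks translates it to that level
    ([lacunary_code]).

    The integers are transported to X by a marker set of small measure that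
    almost every orbit meets ([small_marker]): minus the time left before the
    next visit of the marker is a label that increases by one along orbits
    between two visits, and modulo a fixed period it is almost equidistributed ([measure_level_le]).
    This gives F at every scale ([sparse_lacunary_target]); a sum over sparse
    scales gives one function, whose sums exceed any M_N = o(N (log N)^(1/p))
    infinitely often ([lacunary_divergence]). *)

(** * Powers of a measure-preserving map *)

Section MeasurePreserving.
Context (R : realType) (d : measure_display) (X : measurableType d)
  (mu : probability X R).

Lemma measure_preserving_id : measure_preserving mu id.
Proof. by split; [exact: measurable_id|]. Qed.

Lemma measure_preserving_comp (T S : X -> X) :
  measure_preserving mu T -> measure_preserving mu S ->
  measure_preserving mu (T \o S).
Proof.
move=> [mT T1] [mS S1]; split; first exact: measurableT_comp.
move=> A mA; rewrite comp_preimage S1 ?T1//.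
by rewrite -[X in measurable X]setTI; exact: mT.
Qed.

Lemma measure_preserving_iter (T : X -> X) n :
  measure_preserving mu T -> measure_preserving mu (iter n T).
Proof.
move=> mT; elim: n => [|n IH]; first exact: measure_preserving_id.
exact: (measure_preserving_comp mT IH).
Qed.

Lemma measurable_preimage (T : X -> X) (A : set X) :
  measure_preserving mu T -> measurable A -> measurable (T @^-1` A).
Proof. by move=> [mT _] mA; rewrite -[X in measurable X]setTI; exact: mT. Qed.

Lemma measure_preserving_ae (T : X -> X) (P : X -> Prop) :
  measure_preserving mu T ->
  {ae mu, forall x, P x} -> {ae mu, forall x, P (T x)}.
Proof.
move=> mT [A [mA A0 PA]]; exists (T @^-1` A); split.
- exact: measurable_preimage.
- by rewrite mT.2.
- by move=> x /= Px; apply: PA.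
Qed.

Lemma measure_ae_eq (A B : set X) : measurable A -> measurable B ->
  {ae mu, forall x, A x <-> B x} -> mu A = mu B.
Proof.
move=> mA mB [N [mN N0 AB]].
have sub (C D : set X) : measurable C -> measurable D ->
    C `<=` D `|` N -> (mu C <= mu D)%E.
  move=> mC mD CD; rewrite -[leRHS]adde0 -N0.
  apply: (le_trans _ (measureU2 mu mD mN)).
  by apply: le_measure; rewrite ?inE//; exact: measurableU.
have dec x : ~ N x -> (A x <-> B x).
  by move=> Nx; apply: contrapT => ABx; apply/Nx/AB.
apply/eqP; rewrite eq_le; apply/andP; split; apply: sub => // x Cx;
  have [Nx|Nx] := pselect (N x); by [right|left; apply/(dec x)].
Qed.

Lemma measure_preserving_inverse (T S : X -> X) :
  measure_preserving mu T -> inverse_mod0 mu T S -> measure_preserving mu S.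
Proof.
move=> mT [mS ST _]; split => // A mA.
have mSA : measurable (S @^-1` A) by rewrite -[X in measurable X]setTI; exact: mS.
(* The T-preimage of the S-preimage of A is A, up to a null set. *)
rewrite -(mT.2 _ mSA); apply: measure_ae_eq => //.
  exact: measurable_preimage.
by apply: filterS ST => x /= ->.
Qed.

Lemma measure_preserving_zpower (T : X -> X) (a : nat -> int) n :
  measure_preserving mu T -> times mu T a -> (0 < n)%N ->
  measure_preserving mu (zpower mu T (a n)).
Proof.
move=> mT aP n0; have [[S TS]|Ninv] := pselect (invertible mu T).
  case: (a n) => m /=; apply: measure_preserving_iter => //.
  apply: (measure_preserving_inverse mT).
  by rewrite /inverse; case: xgetP => // /(_ S).
by have := aP Ninv n n0; case: (a n) => // m _; exact: measure_preserving_iter.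
Qed.

Lemma ge0_integral_measure_preserving (T : X -> X) (f : X -> \bar R) :
  measure_preserving mu T -> measurable_fun [set: X] f ->
  (forall x, 0 <= f x)%E ->
  (\int[mu]_x f (T x) = \int[mu]_x f x)%E.
Proof.
move=> mT mf f0.
rewrite -[LHS]/(\int[mu]_(x in T @^-1` setT) (f \o T) x)%E.
rewrite -(ge0_integral_pushforward mT.1)//.
apply: eq_measure_integral; first exact: mT.1.
by move=> ? A mA _; exact: mT.2.
Qed.

(** Borel-Cantelli for functions: the series is integrable, hence finite almost
    everywhere, and the terms of a convergent series are eventually small. *)
Lemma ae_summable_terms (g : nat -> X -> \bar R) (e : R) :
  (forall k, measurable_fun [set: X] (g k)) ->
  (forall k x, 0 <= g k x)%E ->
  (\sum_(k <oo) \int[mu]_x g k x < +oo)%E -> 0 < e ->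
  {ae mu, forall x, \forall k \near \oo, (g k x < e%:E)%E}.
Proof.
move=> mg g0 gfin e0.
have mG : measurable_fun [set: X] (fun x => \sum_(k <oo) g k x)%E.
  by apply: ge0_emeasurable_sum.
have iG : mu.-integrable setT (fun x => \sum_(k <oo) g k x)%E.
  apply/integrableP; split => //.
  under eq_integral do rewrite gee0_abs ?nneseries_ge0//.
  by rewrite integral_nneseries.
apply: filterS (integrable_ae measurableT iG) => x /(_ I) xfin.
have lt : (\sum_(k <oo) g k x < +oo)%E by rewrite ltey_eq xfin.
have := nneseries_tail_cvg lt (fun k _ => g0 k x).
move=> /fine_cvgP[fin] /cvgrPdist_lt /(_ e e0) near_e.
near=> k.
have kfin : (\sum_(k <= i <oo) g i x \is a fin_num)%E by near: k.
(* The tails of the series tend to 0 and dominate their first term. *)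
apply: (@le_lt_trans _ _ (\sum_(k <= i <oo) g i x)%E).
  have -> : g k x = (\sum_(k <= i < k.+1) g i x)%E by rewrite big_nat1.
  by apply: (@nneseries_lim_ge _ _ xpredT) => n _ _; exact: g0.
rewrite -(fineK kfin) lte_fin; apply: le_lt_trans (ler_norm _) _.
by rewrite -normrN -sub0r; near: k.
Unshelve. all: by end_near. Qed.
End MeasurePreserving.

(** * Sums over scales of truncated powers *)

Section RealEstimates.
Context (R : realType) (p : R) (hp : 1 < p).
Let s : R := 1 - p^-1.

Lemma conj_exponent_gt0 : 0 < s.
Proof. by rewrite subr_gt0 invf_lt1// (lt_trans ltr01). Qed.
Let s_gt0 := conj_exponent_gt0.
Let p_gt0 : 0 < p. Proof. exact: lt_trans hp. Qed.
Let pV_gt0 : 0 < p^-1. Proof. by rewrite invr_gt0. Qed.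

(** With q = 1 - 1/p, Young's inequality against the constant 1 gives
    x^q <= q x + (1 - q); take x = k / (k + 1) and multiply by (k + 1)^q. *)
Lemma powR_increment_ge (k : nat) :
  s * k.+1%:R `^ (- p^-1) <= k.+1%:R `^ s - k%:R `^ s.
Proof.
set y : R := k.+1%:R; have y0 : 0 < y by rewrite ltr0n.
set x : R := k%:R / y; have x0 : 0 <= x by rewrite divr_ge0// ltW.
have := @conjugate_powR R (x `^ s) 1 s^-1 p (powR_ge0 _ _) ler01.
rewrite invr_gt0 s_gt0 p_gt0 invrK /s subrK => /(_ isT isT erefl).
rewrite mulr1 -powRrM divff ?gt_eqF// powRr1// powR1 mul1r -/s => H.
have -> : (k%:R : R) = x * y by rewrite /x divfK ?gt_eqF.
have ys0 : 0 < y `^ s by rewrite powR_gt0.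
have -> : y `^ (- p^-1) = y `^ s * y^-1.
  rewrite -(powR_inv1 (ltW y0)) -powRD; last by rewrite (gt_eqF y0) implybT.
  by congr (_ `^ _); rewrite /s; ring.
rewrite powRM// ?(ltW y0)//.
have : x `^ s * y `^ s <= (x * s + p^-1) * y `^ s.
  by apply: ler_wpM2r; [exact: ltW|exact: H].
have -> : x = 1 - y^-1.
  rewrite /x (_ : (k%:R : R) = y - 1) ?mulrBl ?divff ?gt_eqF ?mul1r//.
  by rewrite /y -addn1 natrD addrK.
set xs := _ `^ s; set ys := y `^ s; rewrite /s.
move: (y^-1) xs ys p^-1 => v xs ys q; lra.
Qed.

Lemma sum_powR_le (n : nat) :
  \sum_(0 <= k < n) k.+1%:R `^ (- p^-1) <= s^-1 * n%:R `^ s.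
Proof.
elim: n => [|n IH].
  by rewrite big_nil mulr_ge0 ?invr_ge0 ?powR_ge0 ?(ltW s_gt0).
rewrite big_nat_recr//=.
have := powR_increment_ge n; rewrite -ler_pdivlMl// => H.
by apply: (le_trans (lerD IH H)); rewrite -mulrDr addrC subrK.
Qed.

(** The part of t that is not controlled by c (k + 1)^(1/p), measured in
    units of (k + 1)^(1/p).  At scale 2^(k+1) the factor (k + 1)^(1/p) plays
    the role of (log N)^(1/p). *)
Definition scaled_excess (c : R) (k : nat) (t : R) : R :=
  if c * k.+1%:R `^ p^-1 < t then t * k.+1%:R `^ (- p^-1) else 0.

Lemma scaled_excess_ge0 c k t : 0 <= t -> 0 <= scaled_excess c k t.
Proof. by move=> t0; rewrite /scaled_excess; case: ifP => // _; rewrite mulr_ge0 ?powR_ge0. Qed.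

(** This is where p > 1 matters.  Only the indices with (k + 1)^(1/p) < t / c
    contribute, and over them the sum of (k + 1)^(-1/p) is of order
    (t / c)^(p - 1); for p = 1 it would be logarithmic in t. *)
Lemma sum_scaled_excess_le c t n : 0 < c -> 0 <= t ->
  \sum_(0 <= k < n) scaled_excess c k t <= s^-1 * c `^ (1 - p) * t `^ p.
Proof.
move=> c0 t0; elim: n => [|n IH].
  by rewrite big_nil !mulr_ge0 ?invr_ge0 ?powR_ge0 ?(ltW s_gt0).
have [nt|nt] := ltP (c * n.+1%:R `^ p^-1) t; last first.
  by rewrite big_nat_recr//= /scaled_excess ltNge nt/= addr0.
have tpos : 0 < t by apply: le_lt_trans nt; rewrite mulr_ge0 ?powR_ge0 ?(ltW c0).
apply: (@le_trans _ _ (t * \sum_(0 <= k < n.+1) k.+1%:R `^ (- p^-1))).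
  rewrite mulr_sumr; apply: ler_sum => k _; rewrite /scaled_excess.
  by case: ifP => // _; rewrite mulr_ge0 ?powR_ge0.
have -> : s^-1 * c `^ (1 - p) * t `^ p = t * (s^-1 * (t / c) `^ (p - 1)).
  rewrite powRM ?invr_ge0 ?(ltW c0)// -(powR_inv1 (ltW c0)) -powRrM.
  rewrite -(mulr_powRB1 t0 p_gt0) mulN1r opprB; ring.
apply: ler_wpM2l => //; apply: (le_trans (sum_powR_le n.+1)).
rewrite ler_pM2l ?invr_gt0//.
(* Since s = (p - 1) / p, (n + 1)^s is the power p - 1 of (n + 1)^(1/p) < t/c. *)
have -> : s = p^-1 * (p - 1) by rewrite /s mulrBr mulVf ?mulr1 ?gt_eqF.
rewrite powRrM; apply: ge0_ler_powR; rewrite ?nnegrE ?subr_ge0 ?powR_ge0 ?ltW//.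
  by rewrite divr_gt0.
by rewrite ltr_pdivlMr// mulrC.
Qed.

Lemma ln2_ge : 2^-1 <= ln 2 :> R.
Proof.
have := @le_ln1Dx R (- 2^-1); rewrite -subr_gt0 opprK.
have -> : 1 + - 2^-1 = 2^-1 :> R by field.
rewrite lnV ?posrE//; lra.
Qed.

(** Compare N with the power of 2 just above it: the terms below the threshold
    c (k + 1)^(1/p) contribute at most that threshold each, the excesses are
    small on average by assumption, and k is comparable to log N. *)
Lemma near_sum_le (c : R) (u : nat -> R) : 0 < c -> (forall n, 0 <= u n) ->
  (\forall k \near \oo, (2 ^ k.+1)%N%:R^-1 *
     \sum_(1 <= n < (2 ^ k.+1).+1) scaled_excess c k (u n) < c) ->
  \forall N \near \oo,
    \sum_(1 <= n < N.+1) u n <= 16 * c * (N%:R * ln N%:R `^ p^-1).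
Proof.
move=> c0 u0 [K _ HK]; exists (2 ^ K.+1)%N => // N /= KN.
have N0 : (0 < N)%N by apply: leq_trans KN; rewrite expn_gt0.
set k := trunc_log 2 N.
have /andP[kN Nk] : (2 ^ k <= N < 2 ^ k.+1)%N by exact: trunc_log_bounds.
have Kk : (K < k)%N by rewrite /k trunc_log_max.
have {}HK := HK k (ltnW Kk).
set a := k.+1%:R `^ p^-1 : R.
have a0 : 0 < a by rewrite powR_gt0 ?ltr0n.
have ut n : u n <= a * (c + scaled_excess c k (u n)).
  rewrite mulrDr /scaled_excess; case: ltP => h.
    rewrite powRN -/a [a * (_ / _)]mulrC divfK ?gt_eqF// lerDr.
    by rewrite mulr_ge0 ?ltW.
  by rewrite mulr0 addr0 mulrC.
have S1 : \sum_(1 <= n < N.+1) u n <= \sum_(1 <= n < (2 ^ k.+1).+1) u n.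
  rewrite [leRHS](big_cat_nat (n := N.+1))//=; last by rewrite ltnS ltnW.
  by rewrite lerDl sumr_ge0.
apply: (le_trans S1).
apply: (@le_trans _ _ (a * ((2 ^ k.+1)%N%:R * c + (2 ^ k.+1)%N%:R * c))).
  apply: (le_trans (ler_sum _ (fun n _ => ut n))).
  rewrite -mulr_sumr ler_pM2l// big_split/= sumr_const_nat subn1/=.
  rewrite -[c *+ _]mulr_natl lerD2l; move: HK; rewrite mulrC ltr_pdivrMr ?ltr0n ?expn_gt0//.
  by rewrite mulrC => /ltW.
have pow2 : (2 ^ k.+1)%N%:R <= 2 * N%:R :> R.
  by rewrite -natrM ler_nat expnS leq_mul2l.
(* k ln 2 <= ln N, ln 2 >= 1/2 and k + 1 <= 2 k give the factor 4. *)
have k4 : k.+1%:R <= 4 * ln N%:R :> R.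
  have h1 : k%:R * ln 2 <= ln N%:R :> R.
    rewrite mulr_natl -lnXn// ler_ln ?posrE ?exprn_gt0 ?ltr0n//.
    by rewrite -natrX ler_nat.
  have h2 : k.+1%:R <= 2 * k%:R :> R by rewrite -natrM ler_nat; lia.
  have k0 : 0 <= k%:R :> R by [].
  have := ln2_ge; move: h1 h2 k0; move: (ln 2) (ln N%:R) (k%:R) (k.+1%:R).
  move=> l2 lN k' k1 *; nra.
have lnN0 : 0 <= ln N%:R :> R by rewrite ln_ge0// ler1n.
have ale : a <= 4 * ln N%:R `^ p^-1.
  apply: (@le_trans _ _ ((4 * ln N%:R) `^ p^-1)).
    by apply: ge0_ler_powR; rewrite ?nnegrE ?mulr_ge0 ?(ltW pV_gt0).
  rewrite powRM// ler_wpM2r ?powR_ge0//.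
  have -> : (4 : R) = 4 `^ 1 by rewrite powRr1.
  rewrite -powRrM mul1r; apply: ler_powR; first lra.
  by rewrite invf_le1// ltW.
have -> : 16 * c * (N%:R * ln N%:R `^ p^-1) =
  (4 * ln N%:R `^ p^-1) * ((2 * N%:R) * c + (2 * N%:R) * c) by ring.
have c0' := ltW c0; apply: ler_pM => //; first exact: ltW.
  by rewrite addr_ge0// mulr_ge0.
by rewrite lerD// ler_wpM2r.
Qed.

End RealEstimates.

(** * Averages of identically distributed functions *)

Section Upper.
Context (R : realType) (d : measure_display) (X : measurableType d)
  (mu : probability X R).

Lemma integral_average (tau : nat -> X -> X) (h : X -> R) (N : nat) :
  (forall n, (0 < n)%N -> measure_preserving mu (tau n)) ->
  measurable_fun [set: X] h -> (forall x, 0 <= h x) -> (0 < N)%N ->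
  (\int[mu]_x (N%:R^-1 * \sum_(1 <= n < N.+1) h (tau n x))%:E
    = \int[mu]_x (h x)%:E)%E.
Proof.
move=> mtau mh h0 N0.
have mhn n : (0 < n)%N -> measurable_fun [set: X] (fun x => (h (tau n x))%:E).
  move=> n0; apply/measurable_EFinP.
  exact: measurableT_comp mh (mtau n n0).1.
under eq_integral do rewrite EFinM -sumEFin big_add1/=.
rewrite ge0_integralZl_EFin ?invr_ge0//; last 2 first.
  by move=> x _; rewrite sume_ge0// => n _; rewrite lee_fin.
  by apply: emeasurable_sum => n; exact: mhn.
rewrite ge0_integral_sum//; last 2 first.
  by move=> n; exact: mhn.
  by move=> n x _; rewrite lee_fin.
under eq_bigr => n _.
  rewrite (@ge0_integral_measure_preserving _ _ _ mu (tau n.+1) (EFin \o h)).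
  over.
  - exact: mtau.
  - exact/measurable_EFinP.
  - by move=> x; rewrite lee_fin.
rewrite sumr_const_nat subn0 -[X in (_ * X)%E]mule_natl.
by rewrite muleA -EFinM mulVf ?pnatr_eq0 -?lt0n// mul1e.
Qed.

Context (p : R) (hp : 1 < p).

Lemma measurable_scaled_excess (c : R) k (f : X -> R) : measurable_fun [set: X] f ->
  measurable_fun [set: X] (fun x => scaled_excess p c k `|f x|).
Proof.
move=> mf; rewrite /scaled_excess.
have mnf : measurable_fun [set: X] (fun x => `|f x|) by exact: measurableT_comp.
apply: measurable_fun_ifT => //; first exact: measurable_fun_ltr.
exact: measurable_funM.
Qed.

(** The normalised averages of the excesses over the first 2^(k+1) times have,
    by invariance of the measure, integrals equal to those of the excess of
    |f|; these are summable over k because their sum is at most a constant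
    times the integral of |f|^p. *)
Lemma ae_near_sum_le (tau : nat -> X -> X) (f : X -> R) (c : R) :
  (forall n, (0 < n)%N -> measure_preserving mu (tau n)) ->
  f \in Lfun mu p%:E -> 0 < c ->
  {ae mu, forall x, \forall N \near \oo,
    \sum_(1 <= n < N.+1) `|f (tau n x)| <= 16 * c * (N%:R * ln N%:R `^ p^-1)}.
Proof.
move=> mtau fLp c0.
have p1 := ltW hp.
have mf : measurable_fun [set: X] f by move: fLp; rewrite inE => /andP[/[!inE]].
have fint := Lfun_integrable p1 fLp.
pose h k x := scaled_excess p c k `|f x|.
have mh k : measurable_fun [set: X] (h k) by exact: measurable_scaled_excess.
have h0 k x : 0 <= h k x by exact: scaled_excess_ge0.
pose g k x := (((2 ^ k.+1)%N%:R^-1 *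
  \sum_(1 <= n < (2 ^ k.+1).+1) h k (tau n x))%:E)%E.
have mg k : measurable_fun [set: X] (g k).
  apply/measurable_EFinP; apply: measurable_funM => //.
  under eq_fun do rewrite big_add1/=.
  by apply: measurable_sum => n; apply: measurableT_comp (mh k) (mtau n.+1 _).1.
have g0 k x : (0 <= g k x)%E by rewrite lee_fin mulr_ge0// sumr_ge0.
have gfin : (\sum_(k <oo) \int[mu]_x g k x < +oo)%E.
  under eq_eseriesr do rewrite integral_average ?expn_gt0//.
  rewrite -integral_nneseries//; last 2 first.
    by move=> k; exact/measurable_EFinP.
    by move=> k x _; rewrite lee_fin.
  set C : R := (1 - p^-1)^-1 * c `^ (1 - p).
  have C0 : 0 <= C by rewrite mulr_ge0 ?powR_ge0// invr_ge0 ltW// conj_exponent_gt0.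
  apply: (@le_lt_trans _ _ (\int[mu]_x (C%:E * (`|f x| `^ p)%:E))%E).
    apply: ge0_le_integral => //.
    - by move=> x _; apply: nneseries_ge0 => k _ _; rewrite lee_fin.
    - apply: ge0_emeasurable_sum => // k; first by move=> x _ _; rewrite lee_fin.
      by move=> _; exact/measurable_EFinP.
    - by apply: emeasurable_funM => //; exact: (measurable_int _ fint).
    - move=> x _; apply: lime_le.
        by apply: is_cvg_nneseries => k _ _; rewrite lee_fin.
      apply: nearW => n; rewrite sumEFin -EFinM lee_fin.
      exact: sum_scaled_excess_le.
  rewrite ge0_integralZl_EFin//.
  - have /integrableP[_] := fint.
    under eq_integral do rewrite gee0_abs ?lee_fin ?powR_ge0//.
    by move=> lty; rewrite lte_mul_pinfty ?lee_fin.
  - exact: (measurable_int _ fint).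
have := ae_summable_terms mg g0 gfin c0.
apply: filterS => x near_g.
apply: (@near_sum_le R p hp c (fun n => `|f (tau n x)|)) => //.
Qed.

Lemma sampled_average_cvg0 (T : X -> X) (f : X -> R) (a : nat -> int) :
  measure_preserving mu T -> f \in Lfun mu p%:E -> times mu T a ->
  {ae mu, forall x,
    (fun N : nat => (N%:R * ln N%:R `^ p^-1)^-1 * sampled_sum mu T a f N x)
      @ \oo --> (0 : R)}.
Proof.
move=> mT fLp aP.
have mtau n : (0 < n)%N -> measure_preserving mu (zpower mu T (a n)).
  exact: measure_preserving_zpower.
have : {ae mu, forall x, forall m : nat, \forall N \near \oo,
    \sum_(1 <= n < N.+1) `|f (zpower mu T (a n) x)|
      <= 16 * m.+1%:R^-1 * (N%:R * ln N%:R `^ p^-1)}.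
  apply: ae_foralln => m.
  by apply: (ae_near_sum_le (tau := fun n => zpower mu T (a n))).
apply: filterS => x Hx; apply/cvgr0Pnorm_le => e e0.
pose m := Num.truncn (16 / e).
have me : 16 * m.+1%:R^-1 <= e.
  rewrite ler_pdivrMr// mulrC -ler_pdivrMr//.
  by apply/ltW; rewrite truncnS_gt.
near=> N.
have N1 : (1 < N)%N by near: N; exact: nbhs_infty_gt.
have D0 : 0 < N%:R * ln N%:R `^ p^-1 :> R.
  by rewrite mulr_gt0 ?ltr0n ?(ltnW N1)// powR_gt0// ln_gt0// ltr1n.
rewrite normrM normfV (gtr0_norm D0) ler_pdivrMl//.
apply: (le_trans (ler_norm_sum _ _ _)).
apply: (@le_trans _ _ (16 * m.+1%:R^-1 * (N%:R * ln N%:R `^ p^-1))).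
  by near: N; exact: Hx.
by rewrite mulrC ler_wpM2l// ltW.
Unshelve. all: by end_near. Qed.

End Upper.

(** * Small sets met by almost every orbit *)

Section Markers.
Context (R : realType) (d : measure_display) (X : measurableType d)
  (mu : probability X R) (T : X -> X).
Context (mT : measure_preserving mu T).

Let miter n : measure_preserving mu (iter n T).
Proof. exact: measure_preserving_iter. Qed.

(** Almost every x differs from T x, ..., T^n x, so for each i <= n some
    separating set contains x and not T^i x.  The set of the points for which
    a prescribed list of n separating sets does this is disjoint from its
    first n preimages, and there are countably many lists. *)
Lemma separated_cover n : countably_separated mu -> aperiodic mu T ->
  exists A : nat -> set X,
    [/\ forall m, measurable (A m),
        forall m i x, (0 < i <= n)%N -> A m x -> ~ A m (iter i T x) &
        {ae mu, forall x, exists m, A m x}].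
Proof.
move=> [X0 [E [X0null mE sepE]]] aper.
(* The separating family is closed under complement, to separate in a given direction. *)
pose E' k : set X := if odd k then ~` E k./2 else E k./2.
have mE' k : measurable (E' k) by rewrite /E'; case: ifP => _; [exact: measurableC|].
pose code m : seq nat := odflt [::] (unpickle m).
pose A m : set X := \bigcap_(i in `I_n)
  (E' (nth 0%N (code m) i) `&` iter i.+1 T @^-1` ~` E' (nth 0%N (code m) i)).
exists A; split.
- move=> m; apply: bigcap_measurableType => i _; apply: measurableI => //.
  by apply: (measurable_preimage (miter i.+1)); exact: measurableC.
- move=> m [//|i] x /= im Ax ATx.
  by have [_ nE] := Ax i im; have [E'y _] := ATx i im; apply: nE.
- have X0ae : {ae mu, forall x, X0 x} by exact: X0null.
  have Xiter : {ae mu, forall x, forall i, X0 (iter i T x)}.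
    apply: ae_foralln => i; exact: (measure_preserving_ae (miter i) X0ae).
  have nper : {ae mu, forall x, forall i, (0 < i)%N -> iter i T x <> x}.
    apply: negligibleS aper => x /= /existsNP[i /not_implyP[i0 /contrapT xi]].
    by exists i.
  apply: filterS2 Xiter nper => x X0x xper.
  have /choice[c cP] i : exists k, E' k x /\ ~ E' k (iter i.+1 T x).
    have : ~ (forall k, E k x <-> E k (iter i.+1 T x)).
      move=> /sepE xi; apply: (xper i.+1) => //.
      by apply/esym/xi; [exact: (X0x 0%N)|exact: (X0x i.+1)].
    move=> /existsNP[k]; have [Ex|Ex] := pselect (E k x) => nE.
      exists k.*2; rewrite /E' odd_double doubleK; split => //.
      by move=> ETx; apply: nE.
    exists k.*2.+1; rewrite /E' /= odd_double uphalf_double; split => //.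
    by move=> ETx; apply: nE; split => // ?; exfalso; apply: ETx.
  exists (pickle (mkseq c n)) => i /= im.
  by rewrite /code pickleK /= nth_mkseq//; have [] := cP i.
Qed.

(** Poincare recurrence.  The set G j of the points visiting A at a time at
    least j is the j-th preimage of G 0 and is contained in it; having the same
    finite measure, they differ by a null set. *)
Lemma recurrence (A : set X) : measurable A ->
  {ae mu, forall x, A x -> forall j, exists2 i, (j <= i)%N & A (iter i T x)}.
Proof.
move=> mA.
pose G j := \bigcup_(i in [set i | (j <= i)%N]) (iter i T @^-1` A).
have mG j : measurable (G j).
  by apply: bigcup_measurable => i _; exact: (measurable_preimage (miter i)).
have GE j : G j = iter j T @^-1` G 0%N.
  apply/seteqP; split => x.
    move=> [i /= ji Ai]; exists (i - j)%N => //=.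
    by rewrite -iterD subnK.
  by move=> [i _ /= Ai]; exists (i + j)%N; rewrite /= ?leq_addl// iterD.
have G0 j : mu (G 0%N `\` G j) = 0%E.
  rewrite measureD//; last by rewrite (le_lt_trans (probability_le1 _ _))// ltry.
  have -> : G 0%N `&` G j = G j.
    by apply/setIidPr => x [i _ Ai]; exists i.
  rewrite [X in (_ - X)%E](_ : _ = mu (G 0%N)); last by rewrite GE; exact: (miter j).2.
  by rewrite subee// fin_num_measure.
have : {ae mu, forall x, forall j, ~ (G 0%N `\` G j) x}.
  apply: ae_foralln => j; exists (G 0%N `\` G j); split.
  - exact: measurableD.
  - exact: G0.
  - by move=> x /= /contrapT.
apply: filterS => x nGx Ax j.
have [[i ji Ai]|nG] := pselect (G j x); first by exists i.
by exfalso; apply: (nGx j); split => //; exists 0%N.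
Qed.

(** A weak form of Rokhlin's lemma, valid without invertibility.  The sets
    U m of the points visiting A m infinitely often are exactly invariant, so
    the least index m with x in U m is constant along orbits.  Keeping from A m
    only the points of least index m glues the A m into one set B that is still
    disjoint from its first n preimages, whence mu B <= 1 / (n + 1), and that
    almost every orbit meets. *)
Lemma small_marker (eps : R) :
  countably_separated mu -> aperiodic mu T -> 0 < eps ->
  exists A : set X, [/\ measurable A, (mu A <= eps%:E)%E &
    {ae mu, forall x, exists j, A (iter j T x)}].
Proof.
move=> sep aper eps0; pose n := Num.truncn eps^-1.
have [A [mA Adisj Acov]] := separated_cover n sep aper.
pose U m : set X :=
  \bigcap_j \bigcup_(i in [set i | (j <= i)%N]) (iter i T @^-1` A m).
have mU m : measurable (U m).
  apply: bigcapT_measurable => j; apply: bigcup_measurable => i _.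
  exact: (measurable_preimage (miter i)).
have UT k m x : U m (iter k T x) <-> U m x.
  split=> Ux j _.
    have [i /= ji] := Ux j I; rewrite -iterD => Ai.
    by exists (i + k)%N => //=; rewrite (leq_trans ji)// leq_addr.
  have [i /= ji Ai] := Ux (j + k)%N I; exists (i - k)%N => /=; first by lia.
  by rewrite -iterD subnK//; lia.
pose B : set X := \bigcup_m
  (A m `&` U m `&` \bigcap_(l in [set l | (l < m)%N]) ~` U l).
have mB : measurable B.
  apply: bigcupT_measurable => m; apply: measurableI; first exact: measurableI.
  by apply: bigcap_measurableType => l _; exact: measurableC.
have Bdisj i x : (0 < i <= n)%N -> B x -> ~ B (iter i T x).
  move=> i_n [m _ [[Am Um] lm]] [m' _ [[Am' /UT Um'] lm']].
  have mm' : m = m'.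
    apply/eqP; rewrite eqn_leq; apply/andP; split; rewrite leqNgt; apply/negP.
      by move=> /lm; apply.
    by move=> /lm' /=; rewrite /setC /= UT.
  by apply: (Adisj m i x) => //; rewrite mm'.
exists B; split => //.
- have tB : trivIset `I_n.+1 (fun i => iter i T @^-1` B).
    have wlog_lt i j : (i < j <= n)%N ->
        iter i T @^-1` B `&` iter j T @^-1` B !=set0 -> False.
      move=> /andP[ij jn] [x [/= Bi Bj]].
      apply: (Bdisj (j - i)%N _ _ Bi); first by lia.
      by rewrite -iterD subnK// ltnW.
    move=> i j /=; rewrite !ltnS => i_n j_n ijB.
    case: (ltngtP i j) => // ij; exfalso.
      by apply: (wlog_lt i j); rewrite ?ij.
    by apply: (wlog_lt j i); rewrite ?ij// setIC.
  have : (mu (\bigcup_(i in `I_n.+1) (iter i T @^-1` B)) <= 1)%E.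
    apply: probability_le1; apply: bigcup_measurable => i _.
    exact: (measurable_preimage (miter i)).
  rewrite measure_fin_bigcup//; last first.
    by move=> i _; exact: (measurable_preimage (miter i)).
  rewrite -fsbig_ord (eq_bigr (fun=> mu B)); last first.
    by move=> i _; exact: (miter i).2.
  rewrite sumr_const card_ord -[X in (X <= 1)%E]mule_natl.
  rewrite -(@fineK _ (mu B)) ?fin_num_measure// -EFinM !lee_fin => muB.
  apply: (@le_trans _ _ (n.+1%:R^-1)).
    by rewrite -[leRHS]mul1r ler_pdivlMr ?ltr0n// mulrC.
  by rewrite invf_ple ?posrE// ltW// truncnS_gt.
- have Urec : {ae mu, forall x, forall m, A m x -> U m x}.
    apply: ae_foralln => m; apply: filterS (recurrence (mA m)) => x rec Am j _.
    by have [i ji Ai] := rec Am j; exists i.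
  apply: filterS2 Acov Urec => x [m Am] AU.
  have : exists m, `[< U m x >] by exists m; apply/asboolP/AU.
  move=> /ex_minnP[l /asboolP Ul lmin].
  have [i _ Ai] := Ul 0%N I; exists i, l => //; split.
    by split => //; rewrite UT.
  move=> k /= kl; rewrite /setC /= UT => Uk.
  by have := lmin k (asboolT Uk); rewrite leqNgt kl.
Qed.

End Markers.

(** * A sparse set of integers reached by adding powers of 2 *)

Section Counting.
Local Open Scope nat_scope.

Lemma sum_nat_divn (F : nat -> nat) A N : 0 < A ->
  \sum_(0 <= i < N * A) F (i %/ A) = A * \sum_(0 <= j < N) F j.
Proof.
move=> A0; elim: N => [|N IH]; first by rewrite mul0n !big_nil muln0.
rewrite mulSnr (big_cat_nat (n := N * A))//= ?leq_addr// IH.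
rewrite [in RHS]big_nat_recr//= mulnDr; congr (_ + _).
rewrite -{1}[N * A]add0n big_addn addKn.
rewrite (eq_big_nat _ _ (F2 := fun=> F N)); last first.
  by move=> i /andP[_ iA]; rewrite addnC divnMDl// divn_small// addn0.
by rewrite sum_nat_const_nat subn0.
Qed.

Lemma sum_nat_modn (F : nat -> nat) M Q : 0 < M ->
  \sum_(0 <= i < Q * M) F (i %% M) = Q * \sum_(0 <= j < M) F j.
Proof.
move=> M0; elim: Q => [|Q IH]; first by rewrite mul0n big_nil.
rewrite !mulSnr (big_cat_nat (n := Q * M))//= ?leq_addr// IH; congr (_ + _).
rewrite -{1}[Q * M]add0n big_addn addKn; apply: eq_big_nat => i /andP[_ iM].
by rewrite addnC modnMDl modn_small.
Qed.

(** With M' the amount added to the digit, these are the i for which the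
    addition carries. *)
Lemma count_high_digit (A M M' Q : nat) : 0 < A -> 0 < M ->
  \sum_(0 <= i < Q * M * A) (M <= (i %/ A) %% M + M') <= A * (Q * M').
Proof.
move=> A0 M0.
rewrite (sum_nat_divn (fun j => M <= j %% M + M'))//.
rewrite (sum_nat_modn (fun j => M <= j + M'))// !leq_mul2l.
apply/orP; right; apply/orP; right.
have [MM'|MM'] := leqP M M'.
  apply: leq_trans MM'; rewrite -[leqRHS]muln1 -[X in _ <= X * _]subn0 -sum_nat_const_nat.
  by apply: leq_sum => i _; exact: leq_b1.
rewrite (big_cat_nat (n := M - M'))//= ?leq_subr//.
rewrite big_nat_cond big1 ?add0n => [|i]; last first.
  by rewrite andbT => /andP[_ h]; apply/eqP; rewrite eqb0; lia.
rewrite -[leqRHS](subKn (ltnW MM')) -[leqRHS]muln1 -sum_nat_const_nat.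
by apply: leq_sum => i _; exact: leq_b1.
Qed.
End Counting.

(** The code.  Times are grouped in blocks n in [b_k, b_(k+1)) with
    b_k = 4^(K+k), and a number i is written with one large digit per block,
    the binary places from b_k to b_(k+1).  Adding 2^n with n in block k
    changes the k-th digit only, unless that digit overflows, and changes it by
    a number congruent to 1 modulo 3 when n - b_k is even.  A weighted sum of
    the digits in a group of exponent 3 therefore moves by a step depending on
    k alone, and the steps may be prescribed freely: they enumerate the
    group.  Since the blocks grow geometrically, each is a definite
    proportion of the times up to its end, while log n stays comparable to K. *)
Section Code.
Local Open Scope nat_scope.
Context (G : finZmodType).
Context (G3 : forall g : G, (g *+ 3 = 0)%R).
Let K := #|G|.

Definition block k := 4 ^ (K + k).
Definition digit k i := (i %/ 2 ^ block k) %% 2 ^ (3 * block k).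

Lemma blockS k : block k.+1 = 3 * block k + block k.
Proof. by rewrite /block addnS expnS -[4]/(3 + 1) mulnDl mul1n. Qed.

Lemma leq_block j k : j <= k -> block j <= block k.
Proof. by move=> jk; rewrite leq_exp2l// leq_add2l. Qed.

Lemma card_zmod_gt0 : 0 < K.
Proof. by apply/card_gt0P; exists 0%R. Qed.

Lemma even_block k : ~~ odd (block k).
Proof. by rewrite oddX/= orbF addn_eq0 negb_and -lt0n card_zmod_gt0. Qed.

Lemma divn_add_pow i n m : m <= n ->
  (i + 2 ^ n) %/ 2 ^ m = i %/ 2 ^ m + 2 ^ (n - m).
Proof. by move=> mn; rewrite -{1}(subnK mn) expnD divnDMl ?expn_gt0. Qed.

Lemma digit_add_pow_same k i n : block k <= n ->
  digit k i + 2 ^ (n - block k) < 2 ^ (3 * block k) ->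
  digit k (i + 2 ^ n) = digit k i + 2 ^ (n - block k).
Proof.
move=> kn no; rewrite /digit divn_add_pow// -modnDml.
by rewrite modn_small.
Qed.

Lemma digit_add_pow_lower j k i n : j < k -> block k <= n ->
  digit j (i + 2 ^ n) = digit j i.
Proof.
move=> jk kn; have := leq_block jk; rewrite blockS => jk3.
rewrite /digit divn_add_pow; last by lia.
have -> : n - block j = 3 * block j + (n - block j - 3 * block j) by lia.
by rewrite expnD [2 ^ _ * _]mulnC addnC modnMDl.
Qed.

Lemma digit_add_pow_higher j k i n : k < j -> block k <= n ->
  digit k i + 2 ^ (n - block k) < 2 ^ (3 * block k) ->
  digit j (i + 2 ^ n) = digit j i.
Proof.
move=> kj kn no; rewrite /digit; congr (_ %% _).
have kj3 := leq_block kj.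
have -> : block j = block k + (3 * block k + (block j - block k.+1)).
  by move: kj3; rewrite blockS; lia.
move: no; rewrite /digit; set L := 3 * block k => no.
rewrite (expnD _ (block k)) (expnD _ L) !divnMA divn_add_pow//; congr (_ %/ _).
rewrite [in LHS](divn_eq (i %/ _) (2 ^ L)) -addnA divnMDl ?expn_gt0//.
by rewrite (divn_small no) addn0.
Qed.

Definition block_step k : G := nth 0%R (enum G) k.

Definition phase i : G := (\sum_(k < K) block_step k *+ digit k i)%R.

(** 4^m is congruent to 1 modulo 3. *)
Lemma mulrn_pow4 (g : G) m : (g *+ (2 ^ m.*2))%R = g.
Proof.
elim: m => [|m IH]; first by rewrite mulr1n.
by rewrite doubleS !expnS mulnA mulnC mulrnA IH (mulrnDr g 3 1) G3 add0r.
Qed.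

Definition overflow k i := 2 ^ (3 * block k) <= digit k i + 2 ^ (2 * block k).

(** Times n below 3 b_k, in the first two thirds of the block, add
    at most 2^(2 b_k) to a digit ranging up to 2^(3 b_k): overflow is rare. *)
Lemma phase_add_pow (k : 'I_K) i n : ~~ overflow k i -> ~~ odd n ->
  block k <= n < 3 * block k -> phase (i + 2 ^ n) = (phase i + block_step k)%R.
Proof.
rewrite /overflow -ltnNge => nov en /andP[kn nk].
have no : digit k i + 2 ^ (n - block k) < 2 ^ (3 * block k).
  by apply: leq_ltn_trans nov; rewrite leq_add2l leq_exp2l//; lia.
rewrite /phase (bigD1 k)//= [in RHS](bigD1 k)//= digit_add_pow_same// mulrnDr.
have -> : n - block k = (n - block k)./2.*2.
  by rewrite -[LHS]odd_double_half oddB// (negbTE en) (negbTE (even_block k)).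
rewrite mulrn_pow4 -!addrA; congr (_ + _)%R; rewrite addrC; congr (_ + _)%R.
apply: eq_bigr => j jk; congr (_ *+ _)%R.
have [jk'|kj|jk'] := ltngtP j k.
- exact: digit_add_pow_lower kn.
- exact: digit_add_pow_higher no.
- by rewrite (ord_inj jk') eqxx in jk.
Qed.

Definition period := 2 ^ block K.

Lemma block_period k : k < K -> exists Q,
  period = Q * 2 ^ (3 * block k) * 2 ^ block k.
Proof.
move=> kK; exists (2 ^ (block K - block k.+1)).
rewrite -!expnD; congr (2 ^ _); have := leq_block kK; have := blockS k; lia.
Qed.

Lemma digit_mod k i : k < K -> digit k (i %% period) = digit k i.
Proof.
move=> /block_period[Q PE].
rewrite [in RHS](divn_eq i period); set r := i %% period.
rewrite {2}PE /digit mulnA divnMDl ?expn_gt0//.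
by rewrite mulnA modnMDl.
Qed.

Lemma phase_mod i : phase (i %% period) = phase i.
Proof. by apply: eq_bigr => k _; rewrite digit_mod. Qed.

Lemma overflow_mod k i : k < K -> overflow k (i %% period) = overflow k i.
Proof. by move=> kK; rewrite /overflow digit_mod. Qed.

Definition overflowing i := [exists k : 'I_K, overflow k i].

Lemma overflowing_mod i : overflowing (i %% period) = overflowing i.
Proof. by apply: eq_existsb => k; rewrite overflow_mod. Qed.

Lemma count_overflow k : k < K ->
  2 ^ block k * \sum_(0 <= i < period) overflow k i <= period.
Proof.
move=> kK; have [Q PE] := block_period kK; rewrite PE.
have := @count_high_digit (2 ^ block k) (2 ^ (3 * block k)) (2 ^ (2 * block k)) Q.
rewrite !expn_gt0 => /(_ isT isT) H.
apply: (@leq_trans (2 ^ block k * (2 ^ block k * (Q * 2 ^ (2 * block k))))).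
  by rewrite leq_mul2l H orbT.
have -> : 3 * block k = block k + 2 * block k by lia.
by rewrite expnD; lia.
Qed.

Lemma count_overflowing : 2 ^ K * \sum_(0 <= i < period) overflowing i <= period.
Proof.
have K0 := card_zmod_gt0.
have overflowing_le i : overflowing i <= \sum_(k < K) overflow k i.
  case: (boolP (overflowing i)) => // /existsP[k ok].
  by rewrite (bigD1 k)//= ok.
rewrite -(leq_pmul2l K0); apply: leq_trans (_ : \sum_(k < K) period <= _); last first.
  by rewrite sum_nat_const card_ord.
rewrite mulnA; apply: leq_trans (_ : K * 2 ^ K *
  \sum_(k < K) \sum_(0 <= i < period) overflow k i <= _).
  by rewrite leq_mul2l exchange_big/= leq_sum ?orbT.
rewrite big_distrr/=; apply: leq_sum => k _.
apply: leq_trans (count_overflow (ltn_ord k)).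
rewrite leq_mul2r; apply/orP; right.
apply: (@leq_trans (2 ^ (K + K))).
  by rewrite expnD leq_mul2r ltnW ?orbT// ltn_expl.
rewrite leq_exp2l// addnn -mul2n /block.
apply: leq_trans (_ : 4 ^ K <= _); last by rewrite leq_exp2l// leq_addr.
rewrite (_ : 4 = 2 * 2)// expnMn.
by have := ltn_expl K (ltnSn 1); nia.
Qed.

(** The pigeonhole principle over the K values of the phase. *)
Lemma exists_sparse_phase : exists theta : G,
  K * \sum_(0 <= i < period) (phase i == theta) <= period.
Proof.
have K0 := card_zmod_gt0.
apply/existsP; apply: contraT; rewrite negb_exists => /forallP H.
suff : \sum_(th : G) period < \sum_(th : G) K * \sum_(0 <= i < period) (phase i == th).
  rewrite sum_nat_const -big_distrr/= exchange_big/= ltn_pmul2l//.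
  rewrite (eq_bigr (fun=> 1)) => [|i _].
    by rewrite sum_nat_const_nat subn0 muln1 ltnn.
  by rewrite (bigD1 (phase i))//= eqxx big1// => th; rewrite eq_sym => /negbTE ->.
have lt_th th : period < K * \sum_(0 <= i < period) (phase i == th).
  by rewrite ltnNge H.
rewrite (bigD1 0%R)//= [leqRHS](bigD1 0%R)//= -addSn leq_add//.
by apply: leq_sum => th _; exact: ltnW.
Qed.

(** Whatever the phase of i, it differs from theta by an element of the group,
    which is the step of some block; during that block all even times lead to
    the class of theta.  So a set of density at most 1/K is hit, from almost every
    starting point, throughout one of K blocks. *)
Lemma sparse_code : exists F bad : pred nat,
  [/\ forall i, F (i %% period) = F i,
      forall i, bad (i %% period) = bad i,
      K * \sum_(0 <= i < period) F i <= period,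
      2 ^ K * \sum_(0 <= i < period) bad i <= period &
      forall i, ~~ bad i -> exists2 k, k < K & forall n, ~~ odd n ->
        4 ^ (K + k) <= n < 3 * 4 ^ (K + k) -> F (i + 2 ^ n)].
Proof.
have [theta sparse] := exists_sparse_phase.
exists (fun i => phase i == theta), overflowing; split => //.
- by move=> i; rewrite phase_mod.
- exact: overflowing_mod.
- exact: count_overflowing.
- move=> i; rewrite negb_exists => /forallP nov.
  pose g : G := (theta - phase i)%R; pose k := index g (enum G).
  have kK : k < K by rewrite /K cardE index_mem mem_enum.
  exists k => // n en nk.
  rewrite (@phase_add_pow (Ordinal kK))// /block_step nth_index ?mem_enum//.
  by rewrite /g addrC subrK.
Qed.
End Code.

Section LacunaryCode.
Local Open Scope nat_scope.

Lemma lacunary_code (d : nat) (K := 3 ^ d) (P := 2 ^ (4 ^ (K + K))) :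
  exists F bad : pred nat,
  [/\ forall i, F (i %% P) = F i,
      forall i, bad (i %% P) = bad i,
      K * \sum_(0 <= i < P) F i <= P,
      2 ^ K * \sum_(0 <= i < P) bad i <= P &
      forall i, ~~ bad i -> exists2 k, k < K & forall n, ~~ odd n ->
        4 ^ (K + k) <= n < 3 * 4 ^ (K + k) -> F (i + 2 ^ n)].
Proof.
have Z3 (x : 'Z_3) : (x *+ 3 = 0)%R.
  by case: x => [[|[|[|//]]] ?]; exact: val_inj.
have rV3 (g : 'rV['Z_3]_d) : (g *+ 3 = 0)%R.
  by apply/rowP => j; rewrite mulmxnE mxE Z3.
have := sparse_code rV3.
by rewrite /period /block card_mx card_ord mul1n.
Qed.

End LacunaryCode.

(** * Labelling the points of the space by integers *)

Section Towers.
Context (R : realType) (d : measure_display) (X : measurableType d)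
  (mu : probability X R) (T : X -> X).
Context (mT : measure_preserving mu T).

Let miter n : measure_preserving mu (iter n T).
Proof. exact: measure_preserving_iter. Qed.

(** The model is the time left before the orbit meets a marker set; counting
    down rather than up is what makes sense when T is not invertible. *)
Definition countdown (r : X -> nat) : Prop :=
  (forall j, measurable [set x | r x = j]) /\
  (forall x, (0 < r x)%N -> r (T x) = (r x).-1).

Lemma countdown_iter r x m : countdown r -> (m <= r x)%N ->
  r (iter m T x) = (r x - m)%N.
Proof.
move=> [_ rT]; elim: m => [|m IH] mr /=; first by rewrite subn0.
have {}IH := IH (ltnW mr).
by rewrite rT IH ?subn_gt0// subnS.
Qed.

Lemma measurable_countdown r (P : nat -> Prop) : countdown r ->
  measurable [set x | P (r x)].
Proof.
move=> [mr _]; have -> : [set x | P (r x)] = \bigcup_(j in P) [set x | r x = j].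
  apply/seteqP; split => [x Px|x [j Pj /= rx]]; first by exists (r x).
  by rewrite /= rx.
exact: bigcup_measurable.
Qed.

(** The hitting time of a small marker; the value 0 is taken on the marker and
    on the null set of the orbits that never meet it. *)
Lemma exists_countdown (eps : R) :
  countably_separated mu -> aperiodic mu T -> 0 < eps ->
  exists2 r, countdown r & (mu [set x | r x = 0%N] <= eps%:E)%E.
Proof.
move=> sep aper eps0; have [A [mA muA hit]] := small_marker mT sep aper eps0.
have /choice[r rP] x : exists j,
    (A (iter j T x) /\ forall l, (l < j)%N -> ~ A (iter l T x)) \/
    (j = 0%N /\ forall l, ~ A (iter l T x)).
  have [ex|nex] := pselect (exists j, A (iter j T x)); last first.
    by exists 0%N; right; split => // l Al; apply: nex; exists l.
  have : exists j, `[< A (iter j T x) >] by move: ex => [j ?]; exists j; apply/asboolP.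
  move=> /ex_minnP[j /asboolP Aj jmin]; exists j; left; split => // l lj Al.
  by have := jmin l (asboolT Al); rewrite leqNgt lj.
pose never := \bigcap_l ~` (iter l T @^-1` A).
have mpre l : measurable (iter l T @^-1` A) by exact: measurable_preimage (miter l) mA.
have mnever : measurable never.
  by apply: bigcapT_measurable => l; exact: measurableC.
have r0 : [set x | r x = 0%N] = A `|` never.
  apply/seteqP; split => x /=.
    move=> rx; have := rP x; rewrite rx => -[[/= Ax _]|[_ nA]]; [by left|].
    by right => l _; exact: nA.
  have := rP x => -[[Ar rmin]|[-> //]].
  move=> [Ax|nA]; last by have := nA _ I Ar.
  by case: (r x) rmin => // n /(_ 0%N isT).
have rS j : [set x | r x = j.+1] =
    (iter j.+1 T @^-1` A) `&` \bigcap_(l in `I_j.+1) ~` (iter l T @^-1` A).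
  apply/seteqP; split => x /=.
    by move=> rx; have := rP x; rewrite rx => -[[/= Ax rmin]|[]].
  move=> [Aj jmin]; have := rP x => -[[Ar rmin]|[_ nA]]; last by have := nA j.+1 Aj.
  have [rj|jr|//] := ltngtP (r x) j.+1; last by have := rmin _ jr Aj.
  by have := jmin (r x) rj Ar.
have cr : countdown r; first split.
- case=> [|j]; first by rewrite r0; exact: measurableU.
  rewrite rS; apply: measurableI => //.
  by apply: bigcap_measurableType => l _; exact: measurableC.
- move=> x rx; have := rP x => -[[Ar rmin]|[rx0]]; last by rewrite rx0 in rx.
  have AT : A (iter (r x).-1 T (T x)) by rewrite -iterSr prednK.
  have Tmin l : (l < (r x).-1)%N -> ~ A (iter l T (T x)).
    by move=> lr; rewrite -iterSr; apply: rmin; lia.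
  have := rP (T x) => -[[ArT rTmin]|[_ nA]]; last by have := nA _ AT.
  have [lt|lt|//] := ltngtP (r (T x)) (r x).-1; first by have := Tmin _ lt ArT.
  by have := rTmin _ lt AT.
exists r => //; rewrite r0.
apply: (@le_trans _ _ (mu A + mu never)%E); first exact: measureU2.
suff -> : mu never = 0%E by rewrite adde0.
apply/negligibleP => //; apply: negligibleS hit => x /= nx [j Aj].
by have := nx j I Aj.
Qed.

Section Levels.
Context (r : X -> nat) (P : nat).
Context (cr : countdown r) (P0 : (0 < P)%N).

(** A natural number congruent to - r x modulo P: along an orbit it increases
    by one modulo P at each step until the countdown ends. *)
Definition level x := (r x * P.-1)%N.

Lemma level_iter x m : (m <= r x)%N ->
  (level (iter m T x) + m * P)%N = (level x + m)%N.
Proof.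
move=> mr; rewrite /level countdown_iter// -{2}(prednK P0) mulnS.
by rewrite mulnBl; have := leq_mul mr (leqnn P.-1); lia.
Qed.

Lemma measurable_level (Q : nat -> Prop) : measurable [set x | Q (level x)].
Proof. exact: (@measurable_countdown r (fun j => Q (j * P.-1)%N)). Qed.

Context (r0 : (mu [set x | r x = 0%N] <= ((P * P)%N%:R^-1)%:E)%E).

Let E i : set X := [set x | level x = i %[mod P]].
Let mE i : measurable (E i). Proof. exact: (measurable_level (fun l => l = i %[mod P])). Qed.
Let eta : R := (P * P)%N%:R^-1.

(** T maps the residue class i to the class i + 1, except where the countdown
    restarts. *)
Lemma measure_level_step i : (mu (E i) <= mu (E i.+1) + eta%:E)%E.
Proof.
have mE0 : measurable [set x | r x = 0%N] by exact: cr.1.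
rewrite -(mT.2 _ (mE i.+1)); apply: (@le_trans _ _
    (mu (T @^-1` E i.+1 `|` [set x | r x = 0%N]))).
  have mTE := measurable_preimage mT (mE i.+1).
  apply: le_measure; rewrite ?inE//; first exact: measurableU.
  move=> x /= Ex; have [rx|rx] := posnP (r x); [by right|left].
  have := level_iter (m := 1) rx; rewrite /= addn1 => lTx.
  rewrite /E /= -(modnMDl 1 (level (T x))) addnC lTx -addn1 -modnDml Ex modnDml.
  by rewrite addn1.
apply: (@le_trans _ _ (mu (T @^-1` E i.+1) + mu [set x | r x = 0%N])%E).
  by apply: measureU2 => //; exact: measurable_preimage mT (mE i.+1).
by rewrite leeD2l.
Qed.

Lemma measure_level_shift i k : (mu (E i) <= mu (E (i + k)%N) + (k%:R * eta)%:E)%E.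
Proof.
elim: k => [|k IH]; first by rewrite addn0 mul0r adde0.
apply: (le_trans IH); rewrite addnS mulrSr mulrDl mul1r EFinD addeA.
rewrite addeAC leeD2r//; exact: measure_level_step.
Qed.

(** By the previous estimate the P classes have nearly the same measure, so
    none can have much more than 1/P. *)
Lemma measure_level_le i : (mu (E i) <= (2 / P%:R)%:E)%E.
Proof.
have P0' : (0 : R) < P%:R by rewrite ltr0n.
rewrite EFinM lee_pdivlMr//.
have -> : (mu (E i) * P%:R%:E = \sum_(k < P) mu (E i))%E.
  by rewrite sumr_const card_ord muleC mule_natl.
have sum1 : (\sum_(k < P) mu (E (i + k)%N) <= 1)%E.
  rewrite -[leLHS](@measure_bigsetU_ord _ _ _ mu P xpredT (fun k => E (i + k)%N))//.
    by apply: probability_le1; exact: bigsetU_measurable.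
  move=> j k _ _ [x [/= xj xk]]; apply/val_inj/eqP.
  have : i + j == i + k %[mod P] by rewrite -xj xk.
  by rewrite eqn_modDl !modn_small.
apply: (@le_trans _ _ (\sum_(k < P) (mu (E (i + k)%N) + (P%:R * eta)%:E))%E).
  apply: lee_sum => k _; apply: (le_trans (measure_level_shift i k)).
  by rewrite leeD2l// lee_fin ler_wpM2r ?invr_ge0// ler_nat ltnW.
rewrite big_split/= sumr_const card_ord.
rewrite (_ : 2%:E = 1%E + 1%E)%E; last by rewrite -EFinD.
apply: leeD => //; rewrite -[X in (X <= _)%E]mule_natl -EFinM lee_fin /eta.
by rewrite natrM mulrA mulfV// mulf_neq0// gt_eqF.
Qed.

Lemma measure_level_pred (g : pred nat) : (forall i, g (i %% P)%N = g i) ->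
  (mu [set x | g (level x)]
    <= (2 * (\sum_(0 <= i < P) g i)%N%:R / P%:R)%:E)%E.
Proof.
move=> gP.
pose A i := if g i then E i else set0.
have mA i : measurable (A i) by rewrite /A; case: ifP.
have sub : [set x | g (level x)] `<=` \big[setU/set0]_(i < P) A i.
  move=> x /= gx; rewrite -bigcup_mkord.
  exists (level x %% P)%N; first by rewrite /= ltn_mod.
  by rewrite /A gP gx /E /= modn_mod.
apply: (@le_trans _ _ (mu (\big[setU/set0]_(i < P) A i))).
  apply: le_measure; rewrite ?inE//; first exact: (measurable_level g).
  exact: bigsetU_measurable.
apply: (le_trans (Boole_inequality mu (fun i _ => mA i))).
rewrite big_mkord natr_sum mulr_sumr mulr_suml -sumEFin; apply: lee_sum => i _.
rewrite /A; case: ifP => _; last by rewrite measure0 mulr0 mul0r.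
by rewrite mulr1; exact: measure_level_le.
Qed.

Lemma measure_low_countdown :
  (mu [set x | (r x < P)%N] <= (P%:R^-1)%:E)%E.
Proof.
pose D l := iter l T @^-1` [set x | r x = 0%N].
have mD l : measurable (D l).
  exact: measurable_preimage (miter l) (cr.1 0%N).
have sub : [set x | (r x < P)%N] `<=` \big[setU/set0]_(l < P) D l.
  move=> x /= rx; rewrite -bigcup_mkord; exists (r x) => //=.
  by rewrite /D /= countdown_iter// subnn.
apply: (@le_trans _ _ (mu (\big[setU/set0]_(l < P) D l))).
  apply: le_measure; rewrite ?inE//.
    exact: (measurable_countdown (fun j => (j < P)%N) cr).
  exact: bigsetU_measurable.
apply: (le_trans (Boole_inequality mu (fun l _ => mD l))).
apply: (@le_trans _ _ (\sum_(l < P) eta%:E)%E).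
  by apply: lee_sum => l _; rewrite [leLHS](miter l).2//; exact: cr.1.
rewrite sumEFin sumr_const card_ord lee_fin -[leLHS]mulr_natl /eta natrM invfM.
by rewrite mulrA mulfV ?mul1r// pnatr_eq0 -lt0n.
Qed.

End Levels.

(** Transfers the code to X by labelling each point with its level: F is the
    set of the points whose label has the sparse phase, B that of the points
    whose label overflows or whose countdown is too short to add 2^m to the
    label. *)
Lemma sparse_lacunary_target (n : nat) (K := (3 ^ n)%N) :
  countably_separated mu -> aperiodic mu T ->
  exists F B : set X, [/\ measurable F, measurable B,
    (mu F <= (2 / K%:R)%:E)%E,
    (mu B <= (3 / 2 ^+ K)%:E)%E &
    forall x, ~ B x -> exists2 k, (k < K)%N & forall m, ~~ odd m ->
      (4 ^ (K + k) <= m < 3 * 4 ^ (K + k))%N -> F (iter (2 ^ m) T x)].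
Proof.
move=> sep aper; have [f [bad [fP badP fK badK code]]] := lacunary_code n.
move: fP badP fK badK code; rewrite -/K; set P := (2 ^ (4 ^ (K + K)))%N.
move=> fP badP fK badK code.
have P0 : (0 < P)%N by rewrite expn_gt0.
have P0' : 0 < P%:R :> R by rewrite ltr0n.
have K0 : (0 < K)%N by rewrite expn_gt0.
have [r cr r0] := @exists_countdown ((P * P)%N%:R^-1) sep aper
  (ltac:(by rewrite invr_gt0 ltr0n muln_gt0 P0)).
pose l := level r P.
exists [set x | f (l x)], ([set x | bad (l x)] `|` [set x | (r x < P)%N]).
have mbad : measurable [set x | bad (l x)] by exact: (measurable_level P cr bad).
have mlow : measurable [set x | (r x < P)%N].
  exact: (measurable_countdown (fun j => (j < P)%N) cr).
split.
- exact: (measurable_level P cr f).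
- exact: measurableU.
- apply: (le_trans (measure_level_pred cr P0 r0 fP)); rewrite lee_fin -mulrA.
  rewrite ler_pM2l// ler_pdivrMr// ler_pdivlMl ?ltr0n//.
  by rewrite -natrM ler_nat.
- apply: (@le_trans _ _
    (mu [set x | bad (l x)] + mu [set x | (r x < P)%N])%E); first exact: measureU2.
  have := leeD (measure_level_pred cr P0 r0 badP) (measure_low_countdown cr P0 r0).
  move=> /le_trans; apply.
  rewrite -EFinD lee_fin.
  have -> : 3 / 2 ^+ K = 2 / 2 ^+ K + (2 ^+ K)^-1 :> R by ring.
  have K2 : 0 < 2 ^+ K :> R by rewrite exprn_gt0.
  apply: lerD.
    rewrite -mulrA ler_pM2l// ler_pdivrMr// ler_pdivlMl//.
    by rewrite -natrX -natrM ler_nat.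
  rewrite lef_pV2 ?posrE// -natrX ler_nat leq_exp2l//.
  apply: (leq_trans (ltnW (ltn_expl K (isT : 1 < 4)%N))).
  by rewrite leq_exp2l// leq_addr.
- move=> x /not_orP[/= nbad /negP]; rewrite -leqNgt => Pr.
  have [k kK H] := code _ (introN idP nbad); exists k => // m em mk.
  have mP : (2 ^ m <= P)%N.
    rewrite leq_exp2l//; case/andP: mk => _ /ltnW /leq_trans; apply.
    apply: (@leq_trans (4 ^ (K + k).+1)); first by rewrite expnS leq_mul2r orbT.
    by rewrite leq_exp2l//; lia.
  have := H m em mk; rewrite -(level_iter cr P0 (leq_trans mP Pr)).
  by rewrite -fP addnC modnMDl fP.
Qed.

End Towers.

(** * Divergence along the powers of 2 *)

Section Lower.
Context (R : realType).

Lemma nneseries_geometric_lty (u : nat -> \bar R) (C : R) :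
  (forall j, 0 <= u j <= (C / 2 ^+ j)%:E)%E -> (\sum_(j <oo) u j < +oo)%E.
Proof.
move=> uC; have C0 : 0 <= C.
  by have /andP[u0 /(le_trans u0)] := uC 0%N; rewrite lee_fin expr0 divr1.
apply: (@le_lt_trans _ _ (\sum_(j <oo) ((2 * C) / (2 ^ j.+1)%N%:R)%:E)%E).
  apply: lee_nneseries => [j _ _|j _]; first by have /andP[] := uC j.
  have /andP[_ /le_trans] := uC j; apply; rewrite lee_fin natrX exprS invfM.
  by rewrite mulrACA divff// mul1r.
by apply: (le_lt_trans (epsilon_trick0 _ _)); rewrite ?mulr_ge0// ltry.
Qed.

Lemma limn_esup_eqy (u : nat -> R) :
  (forall (B : R) m, exists2 N, (m <= N)%N & B <= u N) ->
  limn_esup (fun N => (u N)%:E) = +oo%E.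
Proof.
move=> uB; apply/eqP; rewrite eq_le leey/=.
apply: le_ereal_inf_tmp => _ [V [m _ mV] <-].
rewrite leye_eq; apply/eqP/eq_infty => B.
have [N mN BN] := uB B m; apply: le_ereal_sup_tmp.
by exists (u N)%:E; [exists N => //; exact: mV|rewrite lee_fin].
Qed.

Lemma sum_even_ge (u : nat -> R) (c : R) b m : ~~ odd b ->
  (forall n, 0 <= u n) ->
  (forall n, ~~ odd n -> (b <= n < b + m.*2)%N -> c <= u n) ->
  m%:R * c <= \sum_(b <= n < b + m.*2) u n.
Proof.
move=> eb u0; elim: m => [|m IH] uc; first by rewrite addn0 big_geq// mul0r.
rewrite doubleS !addnS big_nat_recr ?big_nat_recr//=; try lia.
rewrite mulrSr mulrDl mul1r -addrA; apply: lerD.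
  by apply: IH => n en bn; apply: uc => //; lia.
rewrite -[c]addr0; apply: lerD => //; apply: uc; last by lia.
by rewrite oddD odd_double addbF.
Qed.

Lemma ln_block_le K k : (k < K)%N ->
  ln (3 * 4 ^ (K + k))%N%:R <= 6 * K%:R :> R.
Proof.
move=> kK; apply: (@le_trans _ _ (ln ((4 : R) ^+ (K + K)))).
  rewrite ler_ln ?posrE ?exprn_gt0 ?ltr0n ?muln_gt0 ?expn_gt0//.
  rewrite -natrX ler_nat; apply: (@leq_trans (4 ^ (K + k).+1)).
    by rewrite expnS leq_mul2r orbT.
  by rewrite leq_exp2l//; lia.
rewrite lnXn//.
have : ln (4 : R) <= 3.
  by rewrite (_ : 4 = 1 + 3 :> R); [apply: le_ln1Dx; lra|lra].
rewrite -[ln 4 *+ _]mulr_natl natrD; have : 0 <= K%:R :> R by [].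
move: (ln 4) K%:R => l x *; nra.
Qed.

Context (d : measure_display) (X : measurableType d)
  (mu : probability X R) (T : X -> X) (p : R).
Context (hp : 1 < p) (mT : measure_preserving mu T).

(** At the end N = 3 * 4^(K + k) of the successful block, at least a third of
    the times up to N land in F, where f is at least (K / 2^j)^(1/p), and log N <= 6 K;
    hence the sum is a fixed multiple of 2^(-j) N (log N)^(1/p). *)
Lemma sampled_sum_block_ge (f : X -> R) (F : set X) (M : nat -> R) (j K k : nat) x :
  (forall y, 0 <= f y) -> (k < K)%N ->
  (forall m, (f (iter (2 ^ m) T x) >= (K%:R / 2 ^+ j) `^ p^-1)
     \/ ~ F (iter (2 ^ m) T x)) ->
  (forall m, ~~ odd m -> (4 ^ (K + k) <= m < 3 * 4 ^ (K + k))%N ->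
     F (iter (2 ^ m) T x)) ->
  let N := (3 * 4 ^ (K + k))%N in
  0 < M N ->
  M N <= (18 * j.+1%:R * 2 ^+ j)^-1 * (N%:R * ln N%:R `^ p^-1) ->
  j.+1%:R <= (M N)^-1 *
    sampled_sum mu T (fun n => Posz (2 ^ n)%N) f N x.
Proof.
move=> f0 kK fF HF N MN0 MN.
have p0 : 0 < p by exact: lt_trans hp.
have q0 : 0 <= p^-1 by rewrite invr_ge0 ltW.
have q1 : p^-1 <= 1 by rewrite invf_le1 ?ltW.
set b := (4 ^ (K + k))%N in HF N MN0 MN *.
set c := (K%:R / 2 ^+ j) `^ p^-1 in fF *.
have K0 : (0 < K)%N by lia.
have b0 : (0 < b)%N by rewrite expn_gt0.
have eb : ~~ odd b by rewrite oddX/= orbF addn_eq0 negb_and -lt0n K0.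
have NE : N = (b + b.*2)%N by rewrite /N; lia.
have S1 : b%:R * c <= sampled_sum mu T (fun n => Posz (2 ^ n)%N) f N x.
  rewrite /sampled_sum (big_cat_nat (n := b))//=; last by rewrite /N; lia.
  rewrite big_nat_recr//=; last by rewrite /N; lia.
  apply: (@le_trans _ _ (\sum_(b <= n < N) f (iter (2 ^ n) T x))).
    rewrite NE; apply: sum_even_ge => // n en bn.
    have [//|nF] := fF n; exfalso; apply: nF; apply: HF => //; lia.
  by rewrite addrCA lerDl addr_ge0// sumr_ge0.
rewrite ler_pdivlMl//; apply: le_trans S1.
apply: (le_trans (ler_wpM2r _ MN)) => //.
set Q := K%:R `^ p^-1 : R.
have Q0 : 0 <= Q by exact: powR_ge0.
have lnN : ln N%:R `^ p^-1 <= 6 * Q.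
  apply: (@le_trans _ _ ((6 * K%:R) `^ p^-1)).
    apply: ge0_ler_powR; rewrite ?nnegrE ?mulr_ge0 ?ln_ge0 ?ler1n//.
      by rewrite /N muln_gt0.
    exact: ln_block_le.
  rewrite powRM// ler_wpM2r// -[leRHS]powRr1//; apply: ler_powR => //; lra.
(* As 1/p <= 1, taking the 1/p-th power of 2^(-j) does not decrease it. *)
have cQ : Q / 2 ^+ j <= c.
  rewrite /c powRM// ?invr_ge0 ?exprn_ge0// ler_wpM2l//.
  apply: ger1_powR => //.
  by rewrite invr_gt0 exprn_gt0// invf_le1 ?exprn_gt0// exprn_ege1// ler1n.
apply: (@le_trans _ _ (b%:R * (Q / 2 ^+ j))); last by rewrite ler_wpM2l.
have e2 : 0 < 2 ^+ j :> R by rewrite exprn_gt0.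
have jn : 0 < j.+1%:R :> R by [].
have -> : b%:R * (Q / 2 ^+ j) =
    (18 * j.+1%:R * 2 ^+ j)^-1 * (N%:R * (6 * Q)) * j.+1%:R.
  by rewrite /N natrM; field; rewrite !gt_eqF.
by rewrite ler_wpM2r// ler_wpM2l// ?ler_wpM2l//.
Qed.

Lemma exists_scale (M : nat -> R) (j : nat) :
  (fun N : nat => M N / (N%:R * ln N%:R `^ p^-1)) @ \oo --> (0 : R) ->
  exists n, (j <= 3 ^ n)%N /\ forall N, (4 ^ (3 ^ n) <= N)%N ->
    M N <= (18 * j.+1%:R * 2 ^+ j)^-1 * (N%:R * ln N%:R `^ p^-1).
Proof.
move=> M0; set e := (_)^-1; have e0 : 0 < e.
  by rewrite invr_gt0 !mulr_gt0// exprn_gt0.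
have /cvgr0Pnorm_le/(_ e e0)[m _ Hm] := M0.
exists (maxn j (maxn m 1))%N; set n := maxn _ _.
have n3 : (n <= 3 ^ n)%N by rewrite ltnW// ltn_expl.
have n4 : (3 ^ n <= 4 ^ (3 ^ n))%N by rewrite ltnW// ltn_expl.
split; first by rewrite (leq_trans _ n3)// leq_maxl.
move=> N nN; have mN : (m <= N)%N by rewrite /n in n3 n4 nN *; lia.
have N1 : (1 < N)%N.
  apply: leq_trans nN; apply: (@leq_trans (4 ^ 1)) => //.
  by rewrite leq_exp2l// expn_gt0.
have D0 : 0 < N%:R * ln N%:R `^ p^-1 :> R.
  by rewrite mulr_gt0 ?ltr0n ?(ltnW N1)// powR_gt0// ln_gt0// ltr1n.
by have := Hm N mN => /(le_trans (ler_norm _)); rewrite ler_pdivrMr.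
Qed.

(** The function is the 1/p-th power of the sum of the multiples K_j / 2^j of
    the indicators of sparse targets F_j of measure at most 2 / K_j, so that
    the integral of its p-th power is at most the sum of the 2 / 2^j.  The
    scale K_j is chosen after j, so large that the hypothesis on M beats both
    the loss 2^j and the wanted lower bound j.  The exceptional sets have
    summable measures, so almost every point succeeds at all but finitely many
    stages. *)
Lemma lacunary_divergence (M : nat -> R) :
  countably_separated mu -> aperiodic mu T ->
  (forall N : nat, (0 < N)%N -> 0 < M N) ->
  (fun N : nat => M N / (N%:R * ln N%:R `^ p^-1)) @ \oo --> (0 : R) ->
  exists f : X -> R, f \in Lfun mu p%:E /\
    {ae mu, forall x, limn_esup (fun N : nat => ((M N)^-1 *
      sampled_sum mu T (fun n => Posz (2 ^ n)%N) f N x)%:E) = +oo%E}.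
Proof.
move=> sep aper Mpos M0.
have p0 : 0 < p by exact: lt_trans hp.
have /choice[n nP] j := exists_scale j M0.
pose K j := (3 ^ n j)%N.
have jK j : (j <= K j)%N := (nP j).1.
have K0 j : (0 < K j)%N by rewrite expn_gt0.
have /choice[FB FBP] j : exists FB : set X * set X, [/\ measurable FB.1, measurable FB.2,
    (mu FB.1 <= (2 / (K j)%:R)%:E)%E,
    (mu FB.2 <= (3 / 2 ^+ K j)%:E)%E &
    forall x, ~ FB.2 x -> exists2 k, (k < K j)%N & forall m, ~~ odd m ->
      (4 ^ (K j + k) <= m < 3 * 4 ^ (K j + k))%N -> FB.1 (iter (2 ^ m) T x)].
  by have [F [B FBP]] := sparse_lacunary_target mT (n j) sep aper; exists (F, B).
pose F j := (FB j).1; pose B j := (FB j).2.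
have mF j : measurable (F j) by have [] := FBP j.
have mB j : measurable (B j) by have [] := FBP j.
pose w j : R := (K j)%:R / 2 ^+ j.
have w0 j : 0 <= w j by rewrite divr_ge0// exprn_ge0.
pose g x := (\sum_(j <oo) (w j * \1_(F j) x)%:E)%E.
have t0 j x : (0 <= (w j * \1_(F j) x)%:E)%E by rewrite lee_fin mulr_ge0.
have mt j : measurable_fun [set: X] (fun x => (w j * \1_(F j) x)%:E).
  by apply/measurable_EFinP; apply: measurable_funM => //; exact: measurable_indic.
have mg : measurable_fun [set: X] g.
  by apply: ge0_emeasurable_sum => // k x _ _; exact: t0.
have g0 x : (0 <= g x)%E by apply: nneseries_ge0 => j _ _; exact: t0.
have intg : (\int[mu]_x g x < +oo)%E.
  rewrite integral_nneseries//.
  apply: (@nneseries_geometric_lty _ 2) => j; apply/andP; split.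
    by apply: integral_ge0 => x _; exact: t0.
  under eq_integral do rewrite EFinM.
  rewrite ge0_integralZl_EFin//; last first.
    by apply/measurable_EFinP; exact: measurable_indic.
  rewrite integral_indic// setIT.
  have [_ _ muF _ _] := FBP j.
  apply: (@le_trans _ _ ((w j)%:E * (2 / (K j)%:R)%:E)%E).
    by apply: lee_wpmul2l => //; rewrite lee_fin.
  rewrite -EFinM lee_fin /w mulrC mulrA divfK ?mulrV//.
  by rewrite pnatr_eq0 -lt0n.
have gfin : {ae mu, forall x, g x \is a fin_num}.
  have ig : mu.-integrable setT g.
    apply/integrableP; split => //.
    by under eq_integral do rewrite gee0_abs//.
  by apply: filterS (integrable_ae measurableT ig) => x; apply.
pose f x := fine (g x) `^ p^-1.
have f0 x : 0 <= f x by exact: powR_ge0.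
exists f; split.
  have mf : measurable_fun [set: X] f.
    apply: (measurableT_comp (measurable_powR _)).
    exact: (measurableT_comp (fine_measurable _)).
  rewrite inE; apply/andP; split; rewrite inE//= /finite_norm unlock /=.
  apply: poweR_lty; apply: le_lt_trans intg.
  apply: ge0_le_integral => //.
  - apply/measurable_EFinP; apply: (measurableT_comp (measurable_powR _)).
    exact: measurableT_comp.
  - move=> x _; rewrite /= ger0_norm// /f -powRrM mulVf ?gt_eqF//.
    rewrite powRr1 ?fine_ge0//.
    (* fine sends infinity to 0, so fine (g x) <= g x in all cases. *)
    by have := g0 x; case: (g x) => //= _; exact: leey.
have Bfin : {ae mu, forall x, exists J, forall j, (J <= j)%N -> ~ B j x}.
  have mu0 : mu (lim_sup_set B) = 0%E.
    apply: lim_sup_set_cvg0 => //.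
    apply: (@nneseries_geometric_lty _ 3) => j; apply/andP; split => //.
    have [_ _ _ muB _] := FBP j; apply: (le_trans muB); rewrite lee_fin.
    rewrite ler_pM2l// lef_pV2 ?posrE ?exprn_gt0//.
    by apply: ler_weXn2l => //; rewrite ler1n.
  exists (lim_sup_set B); split => //.
    by apply: bigcapT_measurable => m; apply: bigcup_measurable.
  move=> x /= nx m _; apply: contrapT => nB; apply: nx; exists m => j mj Bj.
  by apply: nB; exists j.
have giter : {ae mu, forall x, forall m, g (iter (2 ^ m) T x) \is a fin_num}.
  apply: ae_foralln => m.
  exact: (measure_preserving_ae (measure_preserving_iter (2 ^ m) mT) gfin).
apply: filterS2 Bfin giter => x [J BJ] gx.
apply: limn_esup_eqy => C m.
pose j := maxn (maxn J m) (Num.truncn C).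
have [k kK HF] : exists2 k, (k < K j)%N & forall m, ~~ odd m ->
      (4 ^ (K j + k) <= m < 3 * 4 ^ (K j + k))%N -> F j (iter (2 ^ m) T x).
  by have [_ _ _ _] := FBP j; apply; apply: BJ; rewrite /j; lia.
set N := (3 * 4 ^ (K j + k))%N.
have KN : (4 ^ K j <= N)%N.
  by rewrite /N expnD; have : (0 < 4 ^ k)%N := (expn_gt0 _ _); nia.
have jN : (j <= N)%N.
  by apply: leq_trans KN; apply: (leq_trans (jK j)); rewrite ltnW// ltn_expl.
exists N; first by rewrite /j in jN *; lia.
have fF i : (f (iter (2 ^ i) T x) >= w j `^ p^-1) \/ ~ F j (iter (2 ^ i) T x).
  have [Fi|nFi] := pselect (F j (iter (2 ^ i) T x)); [left|by right].
  apply: ge0_ler_powR; rewrite ?nnegrE ?fine_ge0 ?w0 ?invr_ge0 ?(ltW p0)//.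
  rewrite -lee_fin fineK//.
  (* One term of the series defining g is already w j. *)
  have -> : (w j)%:E = (\sum_(j <= l < j.+1) (w l * \1_(F l) (iter (2 ^ i) T x))%:E)%E.
    by rewrite big_nat1 indicE mem_set// mulr1.
  apply: (@le_trans _ _ (\sum_(0 <= l < j.+1) (w l * \1_(F l) (iter (2 ^ i) T x))%:E)%E).
    by rewrite [leRHS](big_cat_nat (n := j))//= leeDr// sume_ge0.
  by apply: (@nneseries_lim_ge _ _ xpredT) => l _ _; exact: t0.
have N0 : (0 < N)%N by rewrite /N muln_gt0 expn_gt0.
have := sampled_sum_block_ge f0 kK fF HF (Mpos N N0) ((nP j).2 N KN).
apply: le_trans; apply: ltW; apply: (lt_le_trans (truncnS_gt C)).
by rewrite ler_nat ltnS leq_maxr.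
Qed.

End Lower.

Theorem theorem2 (R : realType) (p : R) (hp : 1 < p) :
  (forall (d : measure_display) (X : measurableType d) (mu : probability X R)
      (T : X -> X) (f : X -> R) (a : nat -> int),
    measure_preserving mu T ->
    f \in Lfun mu p%:E ->
    times mu T a ->
    {ae mu, forall x,
      (fun N : nat => (N%:R * ln N%:R `^ p^-1)^-1 * sampled_sum mu T a f N x)
        @ \oo --> (0 : R)})
  /\
  (forall (d : measure_display) (X : measurableType d) (mu : probability X R)
      (T : X -> X) (M : nat -> R),
    countably_separated mu ->
    measure_preserving mu T ->
    aperiodic mu T ->
    (forall N : nat, (0 < N)%N -> 0 < M N) ->
    (fun N : nat => M N / (N%:R * ln N%:R `^ p^-1)) @ \oo --> (0 : R) ->
    (exists (f : X -> R) (a : nat -> int),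
      [/\ f \in Lfun mu p%:E,
          times mu T a &
          {ae mu, forall x,
            limn_esup (fun N : nat =>
              ((M N)^-1 * sampled_sum mu T a f N x)%:E) = +oo%E}])
    /\
    (exists f : X -> R,
      f \in Lfun mu p%:E /\
      {ae mu, forall x,
        limn_esup (fun N : nat =>
          ((M N)^-1 *
           sampled_sum mu T (fun n => Posz (2 ^ n)%N) f N x)%:E) = +oo%E})).
Proof.
split=> [d X mu T f a|d X mu T M sep mT aper Mpos M0].
  exact: sampled_average_cvg0.
have [f [fLp div]] := lacunary_divergence hp mT sep aper Mpos M0.
split; last by exists f.
by exists f, (fun n => Posz (2 ^ n)%N); split.
Qed.
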